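(* Let $m\ge 1$ be an integer, $a,b>0$, and let $f(t,y)$ be a real-valued function that is continuous in the rectangle $\mathcal{R}=\{(t,y)\in\mathbb{R}^2 : |t-t_0|\le a,\ |y-y_0|\le b\}$, Lipschitz in $\mathcal{R}$ with respect to $y$ with constant $K>0$, and satisfying $|f|\le M$ in $\mathcal{R}$ with $M>0$. Let $y(t)$ be the solution of $y'(t)=f(t,y(t))$, $y(t_0)=y_0$, and suppose $y$ has $m+1$ continuous derivatives. Let $h_0$ with $0<|h_0|\le a$ be such that $|T_{m-1}(t_0,t)-y_0|<b/3$ for all $|t-t_0|\le|h_0|$, where $T_{m-1}(t_0,\cdot)$ is the Taylor polynomial of $y$ of degree $m-1$ at $t_0$. For $0<|h|<\min\{|h_0|,\,b/(3M),\,(m+1)/K\}$, let $\tilde w=\tilde w(h)$ be the fixed point in $[y_0-b/3,\,y_0+b/3]$ of the Spline-Integral Operator $G_h$ with step $h$. Then $$|\tilde w-y(t_0+h)|\ \text{ is }\ \mathcal{O}(h^{m+2})\quad\text{as } h\to 0.$$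
   Context: The Taylor polynomial is $T_{m-1}(t_0,t)=\sum_{k=0}^{m-1}\frac{1}{k!}\frac{d^k y(t_0)}{dt^k}(t-t_0)^k$. For a step $h\neq 0$ and $w\in\mathbb{R}$, the spline of degree $m$ is $$S_m(t_0,t,w)=T_{m-1}(t_0,t)+s_m(t-t_0)^m,\qquad s_m=\frac{w-T_{m-1}(t_0,t_0+h)}{h^m},$$ so that $S_m(t_0,t_0+h,w)=w$. The Spline-Integral Operator with step $h$ is $$G_h(w)=y_0+\int_{t_0}^{t_0+h} f(t,S_m(t_0,t,w))\,dt,$$ defined when $(t,S_m(t_0,t,w))\in\mathcal{R}$ for all $|t-t_0|\le|h|$. Under the stated bounds on $h$, $G_h$ maps $[y_0-b/3,\,y_0+b/3]$ into itself and has a unique fixed point there. *)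

(* Defs.v *)
From Stdlib Require Export Reals Factorial.
From Coquelicot Require Export Coquelicot.
Open Scope R_scope.

Definition rect (t0 y0 a b : R) (p : R * R) : Prop :=
  Rabs (fst p - t0) <= a /\ Rabs (snd p - y0) <= b.

(* [f] only matters on the rectangle, so continuity is relative to it. *)
Definition continuous_on_rect (f : R -> R -> R) (t0 y0 a b : R) : Prop :=
  continuous_on (rect t0 y0 a b) (fun p : R * R => f (fst p) (snd p)).

Definition lipschitz_on_rect (f : R -> R -> R) (t0 y0 a b K : R) : Prop :=
  forall t u v : R, rect t0 y0 a b (t, u) -> rect t0 y0 a b (t, v) ->
    Rabs (f t u - f t v) <= K * Rabs (u - v).

Definition bounded_on_rect (f : R -> R -> R) (t0 y0 a b M : R) : Prop :=
  forall t u : R, rect t0 y0 a b (t, u) -> Rabs (f t u) <= M.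

(* [y] solves y' = f(t, y), y(t0) = y0 on the open interval |t - t0| < r.
   As [f] is only meaningful on the rectangle, the graph of a solution is
   required to lie there. *)
Definition is_solution (f : R -> R -> R) (t0 y0 a b r : R) (y : R -> R) : Prop :=
  y t0 = y0 /\
  forall t : R, Rabs (t - t0) < r ->
    rect t0 y0 a b (t, y t) /\ is_derive y t (f t (y t)).

Definition n_times_cont_diff (y : R -> R) (n : nat) (t0 r : R) : Prop :=
  forall t : R, Rabs (t - t0) < r ->
    (forall k : nat, (k <= n)%nat -> ex_derive_n y k t) /\
    continuous (Derive_n y n) t.

(* Taylor polynomial of degree [n]: [sum_f_R0 _ n] has the n+1 terms k = 0..n. *)
Definition taylor (y : R -> R) (n : nat) (t0 t : R) : R :=
  sum_f_R0 (fun k => / INR (fact k) * Derive_n y k t0 * (t - t0) ^ k) n.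

(* The truncated subtraction [m - 1] is only meaningful for m >= 1. *)
Definition spline_coef (y : R -> R) (m : nat) (t0 h w : R) : R :=
  (w - taylor y (m - 1) t0 (t0 + h)) / h ^ m.

Definition spline (y : R -> R) (m : nat) (t0 h t w : R) : R :=
  taylor y (m - 1) t0 t + spline_coef y m t0 h w * (t - t0) ^ m.

(* [RInt] is oriented, so negative steps [h] are covered. *)
Definition spline_integral_op
    (f : R -> R -> R) (y : R -> R) (m : nat) (t0 y0 h w : R) : R :=
  y0 + RInt (fun t => f t (spline y m t0 h t w)) t0 (t0 + h).

(* The domain of the partial operator G_h. *)
Definition spline_integral_dom
    (y : R -> R) (m : nat) (t0 y0 a b h w : R) : Prop :=
  forall t : R, Rabs (t - t0) <= Rabs h ->
    rect t0 y0 a b (t, spline y m t0 h t w).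

Definition is_spline_fixed_point (f : R -> R -> R) (y : R -> R) (m : nat)
    (t0 y0 a b h w : R) : Prop :=
  (y0 - b / 3 <= w <= y0 + b / 3) /\
  spline_integral_dom y m t0 y0 a b h w /\
  spline_integral_op f y m t0 y0 h w = w.

(* Landau's O along a filter; Coquelicot only provides the little-o [is_domin]. *)
Definition is_bigO {T : Type} (F : (T -> Prop) -> Prop) (f g : T -> R) : Prop :=
  exists C : R, F (fun x => Rabs (f x) <= C * Rabs (g x)).

(* Main.v *)
From Stdlib Require Import Lia Lra.
Require Import Defs.

(** Write [e = w~ - y(t0 + h)] and let [r = y - T_m] be the Taylor remainder,
    which is O(|t - t0|^(m+1)).  The degree-[m] term of [T_m] cancels in
    [S_m(t0, t, w~) - y(t) = e ((t - t0)/h)^m + r(t0 + h) ((t - t0)/h)^m - r(t)],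
    so this difference is at most [|e| + 2 L |h|^(m+1)] for |t - t0| <= |h|.
    Subtracting the integral equations of [w~] and [y] and using the Lipschitz
    condition gives [|e| <= K |h| (|e| + 2 L |h|^(m+1))], and for
    [K |h| <= 1/2] the term in [|e|] on the right is absorbed on the left. *)

(** * Continuity and integrability along graphs in the rectangle *)

(** Passes from the range of an oriented integral to the symmetric condition on [t], so that both
    signs of the step are treated at once. *)
Lemma between_abs (x h t : R) :
  Rmin x (x + h) <= t <= Rmax x (x + h) -> Rabs (t - x) <= Rabs h.
Proof.
unfold Rmin, Rmax; destruct (Rle_dec x (x + h)); intros Ht;
  unfold Rabs; destruct (Rcase_abs (t - x)), (Rcase_abs h); lra.
Qed.

(* [ex_RInt_continuous] demands two-sided continuity at the endpoints;
   precomposing with the clamp to [[a, b]] provides it. *)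
Lemma ex_RInt_continuous_on (g : R -> R) (a b : R) :
  continuous_on (fun t => Rmin a b <= t <= Rmax a b) g -> ex_RInt g a b.
Proof.
intros Hg.
assert (Hab := Rmin_Rmax a b).
set (u := Rmin a b) in *; set (v := Rmax a b) in *.
pose (p := fun t => Rmax u (Rmin v t)).
assert (Hp : forall t, u <= p t <= v).
{ intros t; unfold p, Rmax, Rmin.
  destruct (Rle_dec v t); destruct (Rle_dec u _); lra. }
apply ex_RInt_ext with (fun t => g (p t)).
{ fold u v; intros t Ht; f_equal; unfold p.
  rewrite (Rmin_right v t) by lra; apply Rmax_right; lra. }
apply (ex_RInt_continuous (V := R_CompleteNormedModule)); intros z _.
apply (filterlim_comp _ _ _ p g (locally z)
         (within (fun t => u <= t <= v) (locally (p z)))); [|now apply Hg].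
intros P [d Hd]; exists d; intros t Ht.
apply Hd; [|apply Hp].
change (Rabs (p t - p z) < d).
change (Rabs (t - z) < d) in Ht.
(* The clamp does not increase distances. *)
apply Rle_lt_trans with (2 := Ht).
unfold p, Rmax, Rmin.
destruct (Rle_dec v t), (Rle_dec v z);
  repeat destruct (Rle_dec u _);
  unfold Rabs; repeat destruct Rcase_abs; lra.
Qed.

(** As [f] is continuous only relative to [E], the map t -> (t, s t) has to carry the filter within
    [D] to the filter within [E]. *)
Lemma continuous_on_graph (f : R -> R -> R) (s : R -> R)
    (D : R -> Prop) (E : R * R -> Prop) :
  continuous_on E (fun p => f (fst p) (snd p)) ->
  (forall t, D t -> E (t, s t)) -> (forall t, D t -> continuous s t) ->
  continuous_on D (fun t => f t (s t)).
Proof.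
intros Hf HD Hs t Ht.
apply (filterlim_comp _ _ _ (fun x => (x, s x)) (fun p => f (fst p) (snd p))
         (within D (locally t)) (within E (locally (t, s t))));
  [|exact (Hf _ (HD t Ht))].
intros P [d Hd].
destruct (Hs t Ht (ball (s t) d) (locally_ball _ _)) as [d' Hd'].
exists (mkposreal _ (Rmin_stable_in_posreal d d')); intros x Hx Dx.
apply Hd; [|now apply HD].
split; simpl.
- apply (ball_le _ _ _ (Rmin_l d d')), Hx.
- apply Hd', (ball_le _ _ _ (Rmin_r d d')), Hx.
Qed.

Lemma continuous_taylor (y : R -> R) (n : nat) (t0 t : R) :
  continuous (taylor y n t0) t.
Proof.
unfold taylor; induction n as [|n IHn]; simpl.
- apply continuous_const.
- apply (continuous_plus _ _ _ IHn), ex_derive_continuous.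
  auto_derive; trivial.
Qed.

Lemma continuous_spline (y : R -> R) (m : nat) (t0 h w t : R) :
  continuous (fun t => spline y m t0 h t w) t.
Proof.
apply (continuous_plus _ _ _ (continuous_taylor y _ t0 t)), ex_derive_continuous.
auto_derive; trivial.
Qed.

(** * Two-sided bound on the Taylor remainder *)

(** Lagrange form of the remainder; the factor 1/(n+1)! is estimated by 1, since only the order in t
    - x matters. *)
Lemma taylor_lagrange_bound_right (y : R -> R) (n : nat) (x t B : R) :
  x < t ->
  (forall s, x <= s <= t -> forall k, (k <= S n)%nat -> ex_derive_n y k s) ->
  (forall s, x <= s <= t -> Rabs (Derive_n y (S n) s) <= B) ->
  Rabs (y t - taylor y n x t) <= B * (t - x) ^ S n.
Proof.
intros Hxt Hd HB.
destruct (Taylor_Lagrange y n x t Hxt Hd) as [z [Hz E]].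
assert (HT : taylor y n x t =
  sum_f_R0 (fun k => (t - x) ^ k / INR (fact k) * Derive_n y k x) n).
{ apply sum_eq; intros k _; unfold Rdiv; ring. }
rewrite HT, E.
assert (Hp : 0 < (t - x) ^ S n) by (apply pow_lt; lra).
assert (Hf : 1 <= INR (fact (S n))).
{ apply (le_INR 1), lt_O_fact. }
assert (Hi : 0 < / INR (fact (S n)) <= 1).
{ split; [apply Rinv_0_lt_compat; lra|].
  rewrite <- Rinv_1; apply Rinv_le_contravar; lra. }
assert (HBz := HB z ltac:(lra)).
set (q := (t - x) ^ S n) in *; set (i := / INR (fact (S n))) in *.
set (D := Derive_n y (S n) z) in *.
replace (_ + q / _ * D - _) with (i * (q * D)) by (unfold i, Rdiv; ring).
rewrite !Rabs_mult, (Rabs_pos_eq i), (Rabs_pos_eq q) by lra.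
assert (0 <= q * Rabs D <= B * q).
{ assert (H := Rabs_pos D); split; [|rewrite Rmult_comm]; nra. }
nra.
Qed.

Lemma taylor_center (y : R -> R) (n : nat) (t0 : R) : taylor y n t0 t0 = y t0.
Proof.
unfold taylor; induction n as [|n IHn]; simpl; [field|].
rewrite IHn; ring.
Qed.

(** The k-th derivative of y(-s) and the k-th power each contribute a sign (-1)^k, and the two
    cancel. This reduces points left of the centre to points right of it. *)
Lemma taylor_reflect (y : R -> R) (n : nat) (t0 t : R) :
  locally t0 (fun s => forall k, (k <= n)%nat -> ex_derive_n y k s) ->
  taylor (fun s => y (- s)) n (- t0) (- t) = taylor y n t0 t.
Proof.
intros H; apply sum_eq; intros k Hk.
rewrite Derive_n_comp_opp, Ropp_involutive.
- replace (- t - - t0) with (-1 * (t - t0)) by ring.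
  rewrite Rpow_mult_distr.
  assert (E : (-1) ^ k * (-1) ^ k = 1).
  { rewrite <- Rpow_mult_distr.
    replace (-1 * -1) with 1 by ring; apply pow1. }
  transitivity (/ INR (fact k) * Derive_n y k t0 * (t - t0) ^ k
                * ((-1) ^ k * (-1) ^ k)); [ring|rewrite E; ring].
- rewrite Ropp_involutive.
  apply (filter_imp _ _ (fun s Hs j Hj => Hs j (Nat.le_trans _ _ _ Hj Hk)) H).
Qed.

Lemma taylor_lagrange_bound (y : R -> R) (n : nat) (x d B : R) :
  (forall s, Rabs (s - x) < d ->
    (forall k, (k <= S n)%nat -> ex_derive_n y k s) /\
    Rabs (Derive_n y (S n) s) <= B) ->
  forall t, Rabs (t - x) < d ->
    Rabs (y t - taylor y n x t) <= B * Rabs (t - x) ^ S n.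
Proof.
intros H t Ht.
assert (Hloc : forall s, Rabs (s - x) < d ->
  locally s (fun z => forall k, (k <= S n)%nat -> ex_derive_n y k z)).
{ intros s Hs.
  assert (Hp : 0 < d - Rabs (s - x)) by lra.
  exists (mkposreal _ Hp); intros z Hz; apply H.
  change (Rabs (z - s) < d - Rabs (s - x)) in Hz.
  replace (z - x) with ((z - s) + (s - x)) by ring.
  assert (Htri := Rabs_triang (z - s) (s - x)); lra. }
destruct (Rtotal_order x t) as [L|[->|L]].
- rewrite (Rabs_pos_eq (t - x)) in * by lra.
  apply taylor_lagrange_bound_right; trivial;
    intros s Hs; apply H; rewrite Rabs_pos_eq; lra.
- rewrite taylor_center, !Rminus_diag, Rabs_R0; simpl; lra.
(* Left of the centre, the one-sided bound is applied to s -> y(-s), whose derivatives have the same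
   absolute values. *)
- rewrite (Rabs_left (t - x)) in * by lra.
  assert (Hin : forall s, - x <= s <= - t -> Rabs (- s - x) < d).
  { intros s Hs; rewrite Rabs_left1; lra. }
  rewrite <- taylor_reflect.
  + replace (y t) with (y (- - t)) by (f_equal; ring).
    replace (- (t - x)) with (- t - - x) by ring.
    apply (taylor_lagrange_bound_right (fun s => y (- s))); [lra| |].
    * intros s Hs k Hk; apply ex_derive_n_comp_opp.
      apply (filter_imp _ _ (fun z Hz j Hj => Hz j (Nat.le_trans _ _ _ Hj Hk))
               (Hloc _ (Hin s Hs))).
    * intros s Hs.
      rewrite Derive_n_comp_opp by apply Hloc, Hin, Hs.
      rewrite Rabs_mult, pow_1_abs, Rmult_1_l; apply H, Hin, Hs.
  + apply (filter_imp _ _ (fun z Hz j Hj =>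
      Hz j (Nat.le_trans _ _ _ Hj (Nat.le_succ_diag_r n)))).
    apply Hloc; rewrite Rminus_diag, Rabs_R0; lra.
Qed.

(** By continuity at [t0], the top derivative stays within 1 of its value there on a small interval,
    which gives the constant [L]. *)
Lemma n_times_cont_diff_taylor_bound (y : R -> R) (n : nat) (t0 r : R) :
  0 < r -> n_times_cont_diff y (S n) t0 r ->
  exists d L, 0 < d <= r /\ 0 <= L /\
    forall t, Rabs (t - t0) < d ->
      Rabs (y t - taylor y n t0 t) <= L * Rabs (t - t0) ^ S n.
Proof.
intros Hr Hy.
destruct (Hy t0) as [_ Hc]; [rewrite Rminus_diag, Rabs_R0; lra|].
destruct (Hc _ (locally_ball _ (mkposreal 1 Rlt_0_1))) as [e He].
exists (Rmin e r), (Rabs (Derive_n y (S n) t0) + 1).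
assert (Hm := Rmin_r e r); assert (Hl := Rmin_l e r).
assert (0 < Rmin e r) by (apply Rmin_pos; [apply cond_pos|trivial]).
assert (Ha := Rabs_pos (Derive_n y (S n) t0)).
split; [lra|split; [lra|]].
apply taylor_lagrange_bound; intros s Hs; split.
- apply (Hy s); lra.
- assert (Hb : Rabs (Derive_n y (S n) s - Derive_n y (S n) t0) < 1).
  { apply He; change (Rabs (s - t0) < e); lra. }
  assert (Ht := Rabs_triang_inv (Derive_n y (S n) s) (Derive_n y (S n) t0)).
  lra.
Qed.

(** * Distance between the spline and the solution *)

(** The spline and T_m differ by a multiple of (t - t0)^m. At t0 + h this difference is w - T_m(t0,
    t0 + h), which fixes the factor. *)
Lemma spline_error (y : R -> R) (m : nat) (t0 h t w : R) :
  (1 <= m)%nat -> h <> 0 ->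
  spline y m t0 h t w - y t =
    ((w - y (t0 + h)) + (y (t0 + h) - taylor y m t0 (t0 + h)))
      * ((t - t0) / h) ^ m - (y t - taylor y m t0 t).
Proof.
intros Hm Hh; destruct m as [|n]; [lia|].
unfold spline, spline_coef.
replace (S n - 1)%nat with n by lia.
assert (E : forall s, taylor y (S n) t0 s = taylor y n t0 s +
  / INR (fact (S n)) * Derive_n y (S n) t0 * (s - t0) ^ S n) by reflexivity.
rewrite !E; replace (t0 + h - t0) with h by ring.
unfold Rdiv; rewrite Rpow_mult_distr, pow_inv.
assert (Hp : h ^ S n <> 0) by now apply pow_nonzero.
set (c := / INR (fact (S n)) * _); set (q := h ^ S n) in *.
set (p := (t - t0) ^ S n).
field; exact Hp.
Qed.

Lemma spline_error_bound (y : R -> R) (m : nat) (t0 d L h t w : R) :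
  (1 <= m)%nat -> 0 <= L -> 0 < Rabs h < d ->
  (forall s, Rabs (s - t0) < d ->
    Rabs (y s - taylor y m t0 s) <= L * Rabs (s - t0) ^ S m) ->
  Rabs (t - t0) <= Rabs h ->
  Rabs (spline y m t0 h t w - y t) <=
    Rabs (w - y (t0 + h)) + 2 * L * Rabs h ^ S m.
Proof.
intros Hm HL Hh Hr Ht.
assert (h0 : h <> 0) by (intros ->; rewrite Rabs_R0 in Hh; lra).
rewrite spline_error by trivial.
assert (R1 := Hr (t0 + h)); replace (t0 + h - t0) with h in R1 by ring.
specialize (R1 (proj2 Hh)).
assert (R2 := Hr t ltac:(lra)).
assert (Hq : L * Rabs (t - t0) ^ S m <= L * Rabs h ^ S m).
{ apply Rmult_le_compat_l; trivial.
  apply pow_incr; split; [apply Rabs_pos|trivial]. }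
assert (Hx : Rabs (((t - t0) / h) ^ m) <= 1).
{ rewrite <- RPow_abs, Rabs_div by trivial.
  rewrite <- (pow1 m); apply pow_incr; split.
  - apply Rdiv_le_0_compat; [apply Rabs_pos|lra].
  - apply Rle_div_l; lra. }
set (x := ((t - t0) / h) ^ m) in *.
set (e := w - y (t0 + h)) in *.
set (r1 := y (t0 + h) - _) in *; set (r2 := y t - _) in *.
assert (T1 := Rabs_triang ((e + r1) * x) (- r2)).
assert (T2 := Rabs_triang e r1).
rewrite Rabs_Ropp, Rabs_mult in T1.
assert (P := Rabs_pos (e + r1)); assert (P' := Rabs_pos x).
unfold Rminus; nra.
Qed.

(** * Integral equations and the error of the fixed point *)

(** Fundamental theorem of calculus for y'. The order [S (S n)] supplies a second derivative, hence
    the continuity of y'; m + 1 has this form because m >= 1. *)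
Lemma is_RInt_solution (f : R -> R -> R) (t0 y0 a b r : R) (y : R -> R)
    (n : nat) (h : R) :
  is_solution f t0 y0 a b r y -> n_times_cont_diff y (S (S n)) t0 r ->
  Rabs h < r -> is_RInt (fun t => f t (y t)) t0 (t0 + h) (y (t0 + h) - y0).
Proof.
intros [Hy0 Hy] Hd Hh.
rewrite <- Hy0.
assert (Hin : forall t, Rmin t0 (t0 + h) <= t <= Rmax t0 (t0 + h) ->
  Rabs (t - t0) < r).
{ intros t Ht; apply between_abs in Ht; lra. }
apply is_RInt_ext with (Derive y).
{ intros t Ht; apply is_derive_unique, Hy, Hin; lra. }
apply (is_RInt_derive (V := R_CompleteNormedModule)); intros t Ht.
- apply Derive_correct; exists (f t (y t)); apply Hy, Hin, Ht.
- destruct (Hd t (Hin t Ht)) as [Hk _].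
  apply (ex_derive_continuous (V := R_NormedModule)).
  apply (Hk 2%nat); lia.
Qed.

(** [RInt] is a total function, so the fixed-point equation becomes a genuine integral equation only
    once the integrand is shown to be integrable. *)
Lemma is_RInt_spline_fixed_point (f : R -> R -> R) (y : R -> R) (m : nat)
    (t0 y0 a b h w : R) :
  continuous_on_rect f t0 y0 a b ->
  is_spline_fixed_point f y m t0 y0 a b h w ->
  is_RInt (fun t => f t (spline y m t0 h t w)) t0 (t0 + h) (w - y0).
Proof.
intros Hf [_ [Hdom Hfix]].
replace (w - y0) with (RInt (fun t => f t (spline y m t0 h t w)) t0 (t0 + h))
  by (unfold spline_integral_op in Hfix; lra).
apply (RInt_correct (V := R_CompleteNormedModule)), ex_RInt_continuous_on.
apply continuous_on_graph with (1 := Hf).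
- intros t Ht; apply Hdom, between_abs, Ht.
- intros t _; apply continuous_spline.
Qed.

Lemma spline_fixed_point_error (f : R -> R -> R) (y : R -> R) (m : nat)
    (t0 y0 a b K r d L h w : R) :
  (1 <= m)%nat -> 0 < K -> 0 <= L -> d <= r ->
  continuous_on_rect f t0 y0 a b -> lipschitz_on_rect f t0 y0 a b K ->
  is_solution f t0 y0 a b r y -> n_times_cont_diff y (m + 1) t0 r ->
  (forall s, Rabs (s - t0) < d ->
    Rabs (y s - taylor y m t0 s) <= L * Rabs (s - t0) ^ S m) ->
  0 < Rabs h < d -> Rabs h * K <= / 2 ->
  is_spline_fixed_point f y m t0 y0 a b h w ->
  Rabs (w - y (t0 + h)) <= 4 * K * L * Rabs h ^ (m + 2).
Proof.
intros Hm HK HL Hdr Hf Hlip Hsol Hdiff Hr Hh HhK Hfix.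
destruct m as [|n]; [lia|].
replace (S n + 1)%nat with (S (S n)) in Hdiff by lia.
assert (I1 := is_RInt_spline_fixed_point _ _ _ _ _ _ _ _ _ Hf Hfix).
assert (I2 := is_RInt_solution _ _ _ _ _ _ _ _ h Hsol Hdiff ltac:(lra)).
assert (I := is_RInt_minus _ _ _ _ _ _ I1 I2).
set (E := Rabs (w - y (t0 + h)) + 2 * L * Rabs h ^ S (S n)).
(* By the Lipschitz condition, K times the bound [E] on the spline error dominates the integrand. *)
apply (norm_RInt_le_const_abs (V := R_NormedModule) _ _ _ _ (K * E)) in I.
- replace (t0 + h - t0) with h in I by ring.
  assert (I' : Rabs (w - y (t0 + h)) <= Rabs h * (K * E)).
  { replace (w - y (t0 + h)) with ((w - y0) - (y (t0 + h) - y0)) by ring.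
    exact I. }
  replace (S n + 2)%nat with (S (S (S n))) by lia.
  change (Rabs h ^ S (S (S n))) with (Rabs h * Rabs h ^ S (S n)).
  unfold E in I'.
  set (e := Rabs (w - y (t0 + h))) in *; set (q := Rabs h ^ S (S n)) in *.
  assert (He : 0 <= e) by apply Rabs_pos.
  assert (Hx : Rabs h * K * e <= / 2 * e) by now apply Rmult_le_compat_r.
  (* Here e <= e/2 + 2 K L |h|^(m+2); solving for e doubles the constant to 4 K L. *)
  nra.
- intros t Ht; apply between_abs in Ht.
  apply Rle_trans with (K * Rabs (spline y (S n) t0 h t w - y t)).
  + apply Hlip; [apply Hfix, Ht|apply Hsol; lra].
  + apply Rmult_le_compat_l; [lra|].
    now apply spline_error_bound with (d := d).
Qed.

Theorem mainTheorem4 (m : nat) (t0 y0 a b K M h0 : R) (f : R -> R -> R)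
    (y wt : R -> R)
    (hm : (1 <= m)%nat) (ha : 0 < a) (hb : 0 < b) (hK : 0 < K) (hM : 0 < M)
    (f_cont : continuous_on_rect f t0 y0 a b)
    (f_lip : lipschitz_on_rect f t0 y0 a b K)
    (f_bound : bounded_on_rect f t0 y0 a b M)
    (y_sol : is_solution f t0 y0 a b (Rmin a (b / M)) y)
    (y_diff : n_times_cont_diff y (m + 1) t0 (Rmin a (b / M)))
    (h0_range : 0 < Rabs h0 <= a)
    (h0_taylor : forall t : R, Rabs (t - t0) <= Rabs h0 ->
      Rabs (taylor y (m - 1) t0 t - y0) < b / 3)
    (wt_fixed : forall h : R,
      0 < Rabs h < Rmin (Rabs h0) (Rmin (b / (3 * M)) ((INR m + 1) / K)) ->
      is_spline_fixed_point f y m t0 y0 a b h (wt h)) :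
  is_bigO (locally' 0) (fun h => Rabs (wt h - y (t0 + h)))
    (fun h => h ^ (m + 2)).
Proof.
assert (Hr : 0 < Rmin a (b / M)).
{ apply Rmin_pos; [|apply Rdiv_lt_0_compat]; trivial. }
assert (y_diff' := y_diff).
replace (m + 1)%nat with (S m) in y_diff' by lia.
destruct (n_times_cont_diff_taylor_bound _ _ _ _ Hr y_diff')
  as [d [L [Hd [HL Hrem]]]].
set (r := Rmin (Rabs h0) (Rmin (b / (3 * M)) ((INR m + 1) / K))) in *.
assert (Hr' : 0 < r).
{ apply Rmin_pos; [lra|apply Rmin_pos; apply Rdiv_lt_0_compat; try lra].
  assert (H := pos_INR m); lra. }
assert (HK2 : 0 < / (2 * K)) by (apply Rinv_0_lt_compat; lra).
(* [d] serves the remainder bound, [r] the fixed-point property of [wt h], and [/ (2 * K)] the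
   absorption condition K |h| <= 1/2. *)
assert (He : 0 < Rmin d (Rmin r (/ (2 * K)))).
{ apply Rmin_pos; [lra|now apply Rmin_pos]. }
exists (4 * K * L), (mkposreal _ He); intros h Hh Hh0.
change (Rabs (h - 0) < Rmin d (Rmin r (/ (2 * K)))) in Hh.
rewrite Rminus_0_r in Hh.
apply Rmin_Rgt_l in Hh; destruct Hh as [Hhd Hh].
apply Rmin_Rgt_l in Hh; destruct Hh as [Hhr HhK].
assert (Hpos := Rabs_pos_lt h Hh0).
rewrite Rabs_Rabsolu, <- RPow_abs.
apply spline_fixed_point_error with (5 := f_cont) (6 := f_lip) (7 := y_sol)
  (8 := y_diff) (9 := Hrem); try lra; trivial.
- replace (/ 2) with (/ (2 * K) * K) by (field; lra).
  apply Rmult_le_compat_r; lra.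
- apply wt_fixed; lra.
Qed.
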